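(* Let $(S,\cdot)$ be a semigroup and $A\subseteq S$. Then $A$ is thick if and only if there is a nonempty left u-ideal $L\subseteq A^*$.
   Context: $A$ is thick if for every finite $F\subseteq S$ there is $t\in S$ with $Ft\subseteq A$. Nonstandard setup: sufficiently saturated framework with iterated star map; $S^*$, $S^{**}=(S^* )^*$; for $\beta\in S^*$, $\beta^*\in S^{**}$; operation extended by transfer so $\alpha\cdot\beta^*\in S^{**}$. For $\gamma\in S^{(k)*}$, $\mathcal U_\gamma=\{B\subseteq S:\gamma\in B^{(k)*}\}$; $\gamma\sim\delta$ iff $\mathcal U_\gamma=\mathcal U_\delta$. A set $J\subseteq S^*$ is a left u-ideal if for every $\alpha\in S^*$ and $\beta\in J$ there is $\gamma\in J$ with $\gamma\sim\alpha\cdot\beta^*$. *)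

(* Defs.v *)
From HB Require Import structures.
From mathcomp Require Import all_boot.
From mathcomp Require Import boolp classical_sets functions cardinality.
Set Implicit Arguments.
Unset Strict Implicit.
Unset Printing Implicit Defensive.
Local Open Scope classical_set_scope.
Local Open Scope group_scope.

(* First-order language whose sorts are all types and whose function and
   relation symbols are all functions and all sets (arguments being grouped by
   pairing).  A context lists the sorts of the free variables, which are de
   Bruijn indices.  As [set X] is itself a sort, quantification over subsets,
   membership between two variables, etc. are expressible: this is the
   language of bounded-quantifier formulas of a superstructure, in typed
   form. *)
Inductive var : seq Type -> Type -> Type :=
| var0 (X : Type) (G : seq Type) : var (X :: G) X
| varS (X Y : Type) (G : seq Type) (v : var G X) : var (Y :: G) X.

Inductive term (G : seq Type) : Type -> Type :=
| tvar (X : Type) (v : var G X) : term G X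
| tapp (X Y : Type) (f : X -> Y) (t : term G X) : term G Y
| tpair (X Y : Type) (t : term G X) (u : term G Y) : term G (X * Y)%type.

Inductive formula : seq Type -> Type :=
| fo_rel (G : seq Type) (X : Type) (A : set X) (t : term G X) : formula G
| fo_eq (G : seq Type) (X : Type) (t u : term G X) : formula G
| fo_not (G : seq Type) (p : formula G) : formula G
| fo_and (G : seq Type) (p q : formula G) : formula G
| fo_ex (G : seq Type) (X : Type) (p : formula (X :: G)) : formula G.

Fixpoint env (st : Type -> Type) (G : seq Type) : Type :=
  if G is X :: G' then (st X * env st G')%type else unit.

Fixpoint var_val (st : Type -> Type) (G : seq Type) (X : Type) (v : var G X) :
    env st G -> st X :=
  match v in var G X return env st G -> st X with
  | var0 _ _ => fun e => e.1
  | varS _ _ _ v => fun e => var_val v e.2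
  end.

Fixpoint env_map (st1 st2 : Type -> Type) (h : forall X : Type, st1 X -> st2 X)
    (G : seq Type) : env st1 G -> env st2 G :=
  match G return env st1 G -> env st2 G with
  | [::] => fun e => e
  | X :: G' => fun e => (h X e.1, env_map h e.2)
  end.

Fixpoint term_val (G : seq Type) (X : Type) (t : term G X) (e : env id G) : X :=
  match t in term _ X return X with
  | tvar _ v => var_val v e
  | tapp _ _ f t => f (term_val t e)
  | tpair _ _ t u => (term_val t e, term_val u e)
  end.

Fixpoint holds (G : seq Type) (p : formula G) : env id G -> Prop :=
  match p in formula G return env id G -> Prop with
  | fo_rel _ _ A t => fun e => A (term_val t e)
  | fo_eq _ _ t u => fun e => term_val t e = term_val u e
  | fo_not _ p => fun e => ~ holds p e
  | fo_and _ p q => fun e => holds p e /\ holds q e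
  | fo_ex _ X p => fun e => exists x : X, holds p (x, e)
  end.

(* Typed presentation of a star map.  In a superstructure, [star], [st_elt],
   [st_fun] and [st_set] are all restrictions of the one map x |-> x^*, and
   [st_pair] is the ordinary pair, because (X * Y)^* = X^* * Y^* there.  Since
   [star X] is again a type, the map can be iterated. *)
Record star_map := StarMap {
  star : Type -> Type;
  st_elt : forall X : Type, X -> star X;
  st_fun : forall X Y : Type, (X -> Y) -> star X -> star Y;
  st_set : forall X : Type, set X -> set (star X);
  st_pair : forall X Y : Type, star X -> star Y -> star (X * Y)%type
}.
Arguments st_elt s {X} _.
Arguments st_fun s {X Y} _ _.
Arguments st_set s {X} _ _.
Arguments st_pair s {X Y} _ _.

Fixpoint star_term_val (N : star_map) (G : seq Type) (X : Type)
    (t : term G X) (e : env (star N) G) : star N X :=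
  match t in term _ X return star N X with
  | tvar _ v => var_val v e
  | tapp _ _ f t => st_fun N f (star_term_val t e)
  | tpair _ _ t u => st_pair N (star_term_val t e) (star_term_val u e)
  end.

Fixpoint star_holds (N : star_map) (G : seq Type) (p : formula G) :
    env (star N) G -> Prop :=
  match p in formula G return env (star N) G -> Prop with
  | fo_rel _ _ A t => fun e => st_set N A (star_term_val t e)
  | fo_eq _ _ t u => fun e => star_term_val t e = star_term_val u e
  | fo_not _ p => fun e => ~ star_holds p e
  | fo_and _ p q => fun e => star_holds p e /\ star_holds q e
  | fo_ex _ X p => fun e => exists x : star N X, star_holds p (x, e)
  end.

(* A formula holds of x1, ..., xn iff its star holds of x1^*, ..., xn^*. *)
Definition transfer_principle (N : star_map) : Prop :=
  forall (G : seq Type) (p : formula G) (e : env id G),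
    holds p e <-> star_holds p (env_map (@st_elt N) e).

(* An element B of the star of the powerset of X, seen as an (internal)
   subset of the star of X. *)
Definition internal (N : star_map) (X : Type) (B : star N (set X)) :
    set (star N X) :=
  [set x | st_set N [set p : X * set X | p.2 p.1] (st_pair N x B)].

(* kappa^+-saturation, where kappa is the cardinality of K. *)
Definition saturated (N : star_map) (K : Type) : Prop :=
  forall (X : Type) (B : K -> star N (set X)),
    (forall J : set K, finite_set J ->
       \bigcap_(k in J) internal (B k) !=set0) ->
    \bigcap_k internal (B k) !=set0.

Fixpoint istar (N : star_map) (k : nat) (X : Type) : Type :=
  if k is k'.+1 then star N (istar N k' X) else X.

Fixpoint istar_set (N : star_map) (k : nat) (X : Type) (B : set X) :
    set (istar N k X) :=
  match k return set (istar N k X) with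
  | 0 => B
  | k'.+1 => st_set N (@istar_set N k' X B)
  end.
Arguments istar_set N k {X} B _.

Definition ufilter (N : star_map) (k : nat) (X : Type) (c : istar N k X) :
    set (set X) :=
  [set B | istar_set N k B c].

Definition u_equiv (N : star_map) (X : Type) (j k : nat)
    (c : istar N j X) (d : istar N k X) : Prop :=
  ufilter c = ufilter d.

Section Semigroup.
Variables (N : star_map) (S : semigroupType).

Definition star_mul (x y : star N S) : star N S :=
  st_fun N (fun p : S * S => p.1 * p.2) (st_pair N x y).

Definition star2_mul (x y : star N (star N S)) : star N (star N S) :=
  st_fun N (fun p : star N S * star N S => star_mul p.1 p.2) (st_pair N x y).

(* The product of a and b^*.  Identifying s in S with s^* gives an inclusion
   of S in S^*, which by transfer extends to an inclusion of S^* in S^**; it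
   is the star of the map s |-> s^*, not the map a |-> a^*. *)
Definition mul_star (a b : star N S) : star N (star N S) :=
  star2_mul (st_fun N (st_elt N) a) (st_elt N b).

Definition left_u_ideal (J : set (star N S)) : Prop :=
  forall a b : star N S, J b ->
    exists2 c, J c & u_equiv (j := 1) (k := 2) c (mul_star a b).

End Semigroup.

Definition thick (S : semigroupType) (A : set S) : Prop :=
  forall F : set S, finite_set F ->
    exists t : S, [set s * t | s in F] `<=` A.

(* Main.v *)
Require Import Defs.
From mathcomp Require Import all_boot.
From mathcomp Require Import boolp classical_sets functions cardinality.
Local Open Scope classical_set_scope.

(** Write [s^-1 A] for [{t | s t \in A}] and consider the family of sets made
    of [A] and of all [s^-1 A].  If [A] is thick, this family has the finite
    intersection property, and the desired ideal is the set of the [c] in [S^*]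
    that belong to the star of each of its members: for [b] in that set,
    transfer over [x] puts every [a b^*] in the same double stars, and by
    saturation [a b^*] is equivalent to a point of [S^*].  Conversely, for [b]
    in [L] and [s] in [S], [s^* b^*] belongs to [A^**], so [s^* b] belongs to
    [A^*]; transfer then gives a common [t] for finitely many [s]. *)

Section Transfer.
Context {N : star_map} (transferN : transfer_principle N).

(** Transfer is applied to the closed form: no [x] satisfies [p] and not [q]. The pointwise facts on
    star sets below are instances. *)
Lemma transfer_imp {G : seq Type} {X : Type} (p q : formula (X :: G))
    (e : env id G) :
  (forall x, holds p (x, e) -> holds q (x, e)) ->
  forall x : star N X, star_holds (N := N) p (x, env_map (@st_elt N) e) ->
    star_holds (N := N) q (x, env_map (@st_elt N) e).
Proof.
move=> pq x px; apply: contrapT => nqx.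
have /(transferN _ (fo_not (fo_ex (fo_and p (fo_not q))))) : holds
  (fo_not (fo_ex (fo_and p (fo_not q)))) e.
  by move=> [y [/pq]].
by apply; exists x.
Qed.

(** The set [C] cut out by the term is itself a symbol of the language, so two equivalent formulas
    are transferred. The entries of [e] act as standard parameters. *)
Lemma st_set_comp {G : seq Type} {X Y : Type} (B : set Y) (t : term (X :: G) Y)
    (e : env id G) (x : star N X) :
  st_set N [set y : X | B (term_val t (y, e))] x <->
  st_set N B (star_term_val t (x, env_map (@st_elt N) e)).
Proof.
pose C := [set y : X | B (term_val t (y, e))].
pose p := fo_rel C (tvar (var0 X G)).
split; first exact: (transfer_imp p (fo_rel B t) e).
exact: (transfer_imp (fo_rel B t) p e).
Qed.

Lemma st_set_elt {X : Type} (B : set X) (x : X) :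
  st_set N B (st_elt N x) <-> B x.
Proof.
by apply: iff_sym; exact: (transferN _ (fo_rel B (tvar (var0 X [::]))) (x, tt)).
Qed.

Lemma st_setS {X : Type} (B C : set X) : B `<=` C -> st_set N B `<=` st_set N C.
Proof.
pose v := tvar (var0 X [::]).
exact: (transfer_imp (fo_rel B v) (fo_rel C v) tt).
Qed.

Lemma st_setI {X : Type} (B C : set X) (x : star N X) :
  st_set N (B `&` C) x <-> st_set N B x /\ st_set N C x.
Proof.
pose v := tvar (var0 X [::]).
pose p := fo_rel (B `&` C) v; pose q := fo_and (fo_rel B v) (fo_rel C v).
by split; [exact: (transfer_imp p q tt)|exact: (transfer_imp q p tt)].
Qed.

Lemma st_setC {X : Type} (B : set X) (x : star N X) :
  st_set N (~` B) x <-> ~ st_set N B x.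
Proof.
pose v := tvar (var0 X [::]).
pose p := fo_rel (~` B) v; pose q := fo_not (fo_rel B v).
by split; [exact: (transfer_imp p q tt)|exact: (transfer_imp q p tt)].
Qed.

Lemma st_setT {X : Type} (x : star N X) : st_set N [set: X] x.
Proof.
pose v := tvar (var0 X [::]).
exact: (transfer_imp (fo_eq v v) (fo_rel setT v) tt).
Qed.

Lemma st_set_nonempty {X : Type} (B : set X) :
  st_set N B !=set0 -> B !=set0.
Proof.
exact: (proj2 (transferN _ (fo_ex (fo_rel B (tvar (var0 X [::])))) tt)).
Qed.

Lemma st_set_bigcap {X I : Type} (F : set I) (B : I -> set X) (x : star N X) :
  finite_set F -> (forall i, F i -> st_set N (B i) x) ->
  st_set N (\bigcap_(i in F) B i) x.
Proof.
(* A classical choice structure on [I] allows the finite set [F] to be listed as a sequence. *)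
elim/Pchoice: I => I in F B *.
move=> /finite_seqP[s ->]; elim: s => [|i s IHs] Bx.
  by apply: (st_setS setT) (st_setT x) => y _ j.
have /st_setI : st_set N (B i) x /\ st_set N (\bigcap_(j in [set` s]) B j) x.
  split; first by apply: Bx => /=; rewrite mem_head.
  by apply: IHs => j js; apply: Bx => /=; rewrite inE; apply/orP; right.
apply: st_setS => y [Biy Bsy] j /=.
by rewrite inE => /orP[/eqP->//|]; exact: Bsy.
Qed.

Lemma internal_elt {X : Type} (B : set X) :
  internal (st_elt N B) = st_set N B.
Proof.
apply/predeqP => x; apply: iff_sym.
by have := st_set_comp [set p : X * set X | p.2 p.1]
  (tpair (tvar (var0 X [:: set X])) (tvar (varS X (var0 (set X) [::]))))
  (B, tt) x.
Qed.

Section Saturation.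
Context {X : Type} (saturatedN : saturated N (set X)).

Lemma enlargement (F : set (set X)) :
  (forall J, finite_set J -> J `<=` F -> \bigcap_(B in J) B !=set0) ->
  exists c, forall B, F B -> st_set N B c.
Proof.
(* Saturation is indexed by all of [set X]: [D B] is [B] on [F] and the whole of [X] elsewhere. *)
move=> FIP; pose D B := [set x | F B -> B x].
have [J finJ|c Dc] := saturatedN X (fun B => st_elt N (D B)).
  have [|x Jx] := FIP (J `&` F) (finite_setIl _ finJ); first exact: subIsetr.
  exists (st_elt N x) => B JB; rewrite internal_elt; apply/st_set_elt => FB.
  by apply: Jx.
exists c => B FB; have := Dc B I; rewrite internal_elt.
by apply: st_setS => x; apply.
Qed.

End Saturation.
End Transfer.

Section UEquiv.
Context {N : star_map} (transferN : transfer_principle N).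

(** A finite intersection of members of the ultrafilter of [g] has [g] in its double star, so it is
    nonempty by two downward transfers. Enlargement then gives [c]. *)
Lemma u_equiv_star2 {X : Type} (saturatedN : saturated N (set X))
    (g : star N (star N X)) :
  exists c : star N X, u_equiv (N := N) (X := X) (j := 1) (k := 2) c g.
Proof.
have [J finJ Jg|c gc] := enlargement transferN saturatedN
    (ufilter (N := N) (k := 2) g).
  apply: (st_set_nonempty transferN); apply: (st_set_nonempty transferN).
  exists g; apply: (st_setS transferN) (st_set_bigcap transferN J
    (fun B => st_set N B) g finJ Jg) => y; exact: st_set_bigcap.
(* The inclusion of ultrafilters obtained so far is an equality, by passing to complements. *)
exists c; apply/predeqP => B; split=> [Bc|]; last exact: gc.
apply: contrapT => /(st_setC transferN) nBg.
have /(st_setC transferN) : st_set N (~` B) c; last exact.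
by apply: gc; apply: (st_setS transferN) nBg => y /(st_setC transferN).
Qed.

End UEquiv.

Section StarMul.
Local Open Scope group_scope.
Context {N : star_map} (transferN : transfer_principle N) {S : semigroupType}.

Definition ltrans_preim (s : S) (B : set S) : set S := [set t | B (s * t)].

Lemma star_mul_elt (B : set S) (s : S) (b : star N S) :
  st_set N B (star_mul (st_elt N s) b) <-> st_set N (ltrans_preim s B) b.
Proof.
apply: iff_sym; exact: (st_set_comp transferN B
  (tapp (fun p : S * S => p.1 * p.2)
    (tpair (tvar (varS S (var0 (S : Type) [::])))
       (tvar (var0 (S : Type) [:: S : Type]))))
  (s, tt) b).
Qed.

(** This is the product formula for the ultrafilters of [a] and [b]. For the outer star,
    [st_elt N b] is a standard parameter, and only [a] comes from a variable over [S]. *)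
Lemma mul_starE (B : set S) (a b : star N S) :
  st_set N (st_set N B) (mul_star a b) <->
  st_set N [set s | st_set N (ltrans_preim s B) b] a.
Proof.
have -> : [set s | st_set N (ltrans_preim s B) b] =
    [set s | st_set N B (star_mul (st_elt N s) b)].
  by apply/predeqP => s; apply: iff_sym; exact: star_mul_elt.
apply: iff_sym; exact: (st_set_comp transferN (st_set N B)
  (tapp (fun p : star N S * star N S => star_mul p.1 p.2)
    (tpair (tapp (st_elt N) (tvar (var0 (S : Type) [:: star N S])))
       (tvar (varS S (var0 (star N S) [::])))))
  (b, tt) a).
Qed.

End StarMul.

Section Thick.
Local Open Scope group_scope.
Context {S : semigroupType}.

Lemma thick_ltrans_preim (A F : set S) : thick A -> finite_set F ->
  exists2 t, A t & forall s, F s -> ltrans_preim s A t.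
Proof.
(* Thickness on the empty set provides a point [r] of [S]. Since thickness does not place its [t] in
   [A], the witness is [r * t], where [t] serves [r] and all [s * r]. *)
move=> thA finF; have [r _] := thA set0 (finite_set0 _).
pose F' := r |` [set s * r | s in F].
have [|t tA] := thA F'.
  by rewrite finite_setU; split=> //; exact: finite_image.
exists (r * t); first by apply: tA; exists r => //; left.
move=> s Fs; rewrite /ltrans_preim /= mulgA.
by apply: tA; exists (s * r) => //; right; exists s.
Qed.

End Thick.

Section ThickIdeal.
Local Open Scope group_scope.
Context {N : star_map} (transferN : transfer_principle N) {S : semigroupType}.

Definition thick_ideal (A : set S) : set (star N S) :=
  [set c | st_set N A c /\ forall s, st_set N (ltrans_preim s A) c].

Lemma thick_ideal_nonempty (A : set S) : saturated N (set S) ->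
  thick A -> thick_ideal A !=set0.
Proof.
move=> satN thA.
have [J finJ JF|c cF] := enlargement transferN satN
    (A |` range (ltrans_preim ^~ A)).
  (* Each translate in [J] gets an [s] defining it; for [A] and for sets outside [J] the value is a
     dummy. *)
  have [B|f fP] := @choice _ _ (fun B s => J B -> B = A \/ B = ltrans_preim s A).
    have [r _] := thA set0 (finite_set0 _).
    have [/JF[->|[s _ <-]]|nJB] := pselect (J B); last by exists r.
      by exists r; left.
    by exists s; right.
  have [t At tF] := thick_ltrans_preim _ _ thA (finite_image f finJ).
  by exists t => B JB; have [->//|->] := fP _ JB; apply: tF; exists B.
by exists c; split=> [|s]; apply: cF; [left|right; exists s].
Qed.

Lemma left_u_ideal_thick_ideal (A : set S) : saturated N (set S) ->
  left_u_ideal (thick_ideal A).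
Proof.
move=> satN a b [_ bA]; have [c cab] := u_equiv_star2 transferN satN (mul_star a b).
(* Under this hypothesis the set of [s] in [mul_starE] is all of [S], so its star contains [a]. It
   holds for [A], and for the translates of [A] because a translate of a translate is one by a
   product. *)
have inc B : (forall x, st_set N (ltrans_preim x B) b) -> st_set N B c.
  move=> Bb; suff : ufilter (N := N) (k := 1) c B by [].
  rewrite cab; apply/(mul_starE transferN).
  by apply: (st_setS transferN setT) (st_setT transferN a) => x _; exact: Bb.
exists c => //; split=> [|s]; first exact: inc.
apply: inc => x; have -> // : ltrans_preim x (ltrans_preim s A) =
  ltrans_preim (s * x) A by apply/predeqP => t; rewrite /ltrans_preim /= mulgA.
Qed.

(** With the standard point [st_elt N s] as left factor, the outer star in [mul_starE] collapses to
    membership of [s]. *)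
Lemma left_u_ideal_ltrans_preim (A : set S) (L : set (star N S)) (b : star N S)
    (s : S) : left_u_ideal L -> L `<=` st_set N A -> L b ->
  st_set N (ltrans_preim s A) b.
Proof.
move=> idL LA Lb; have [c /LA Ac cab] := idL (st_elt N s) b Lb.
have : ufilter (N := N) (k := 1) c A by [].
by rewrite cab => /(mul_starE transferN) /(st_set_elt transferN).
Qed.

End ThickIdeal.

Theorem theorem3p2p6 (S : semigroupType) (N : star_map)
    (transferN : transfer_principle N) (saturatedN : saturated N (set S))
    (A : set S) :
  thick A <->
  exists L : set (star N S),
    [/\ L !=set0, left_u_ideal L & L `<=` st_set N A].
Proof.
split=> [thA|[L [[b Lb] idL LA]] F finF].
  exists (thick_ideal A); split; first exact: thick_ideal_nonempty.
    exact: left_u_ideal_thick_ideal.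
  by move=> c [].
have [|t Ft] := st_set_nonempty transferN (\bigcap_(s in F) ltrans_preim s A).
  exists b; apply: st_set_bigcap => // s _.
  exact: (left_u_ideal_ltrans_preim transferN A L).
by exists t => _ [s Fs <-]; exact: Ft.
Qed.
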